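(* Let $P=(G,v_s,V_g)$ where $G=(V,E,c,\Theta)$ is an estimated weighted digraph, $v_s\in V$ and $V_g\subset V$. Run the algorithm BEAST (described in the context) on $P$ with a threshold $u_{prune}\ge U^*$. If a solution exists for $P$, BEAST returns a path $\pi$ from $v_s$ to a node of $V_g$ with $u_{\Theta(\pi)}=U^*$, together with the value $U^*$. If no solution exists, BEAST returns $(\emptyset,\infty)$.
   Context: EWDG: $G=(V,E,c,\Theta)$, with $c:E\to\mathbb{R}^+$ unobservable and $\Theta$ mapping each edge $e$ to a finite non-empty sequence of estimators $\theta_e^1,\dots,\theta_e^{k(e)}$ (each of finite running time), where $\theta_e^i$ returns $(l_e^i,u_e^i)$ with $0\le l_e^i\le c(e)\le u_e^i<\infty$ and $[l_e^j,u_e^j]\subseteq[l_e^i,u_e^i]$ for $i<j$. Tightest bounds: $u_{\Theta(e)}:=u_e^{k(e)}$, and $u_{\Theta(\pi)}:=\sum_{e\in\pi}u_{\Theta(e)}$ for a path $\pi$. A solution is a path from $v_s$ to a node in $V_g$; $U^*:=\min\{u_{\Theta(\pi)}:\pi\text{ a solution}\}$ (with $U^*=\infty$ if no solution exists). Algorithm BEAST (input $P$, parameter $u_{prune}$): set $g_u(v_s)=0$, OPEN $=\{v_s\}$ (key $g_u$), CLOSED $=\emptyset$. While OPEN is non-empty: pop $n$ from OPEN with minimal $g_u(n)$; if $n\in V_g$, return the path obtained by following parent pointers from $n$ back to $v_s$, together with $g_u(n)$. Otherwise insert $n$ into CLOSED, and for each successor $s$ of $n$ (edge $e=(n,s)$):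 if $s\notin$ OPEN $\cup$ CLOSED set $g_u(s)=\infty$; set $l(e)=0,u(e)=0$; while $g_u(n)+l(e)<g_u(s)$ and $g_u(n)+l(e)\le u_{prune}$ and estimators remain for $e$, apply the next estimator of $e$ (starting from $\theta_e^1$) and set $(l(e),u(e))$ to its output; then let $\tilde g=g_u(n)+u(e)$; if $\tilde g<g_u(s)$ and $\tilde g\le u_{prune}$, set $g_u(s)=\tilde g$, remove $s$ from OPEN if present, and insert $s$ into OPEN with key $g_u(s)$ and parent $n$. If OPEN becomes empty, return $(\emptyset,\infty)$. *)

(* Defs.v *)
From HB Require Import structures.
From mathcomp Require Import all_boot all_order all_algebra.
From mathcomp Require Import all_classical all_reals ereal.

Set Implicit Arguments.
Unset Strict Implicit.
Unset Printing Implicit Defensive.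

Import Order.TTheory GRing.Theory Num.Theory.

Local Open Scope classical_set_scope.
Local Open Scope ring_scope.
Local Open Scope ereal_scope.

(** ** Estimated weighted digraphs *)

(** An edge is an ordered pair of vertices.  An estimator is represented by the
    pair (l, u) of bounds that it returns.  Costs and estimators are total
    functions on pairs, of which only the values on [edges] are constrained.
    Costs are only required to be nonnegative, which covers both usages of
    R^+. *)
Record ewdg (R : realType) (V : finType) := EWDG {
  edges : {set V * V};
  ecost : V * V -> R;
  Theta : V * V -> seq (R * R);
  ecost_ge0 : forall e, e \in edges -> (0 <= ecost e)%R;
  Theta_neq0 : forall e, e \in edges -> Theta e <> [::];
  Theta_bounds : forall e, e \in edges -> forall i, (i < size (Theta e))%N ->
    let: (l, u) := nth (0, 0)%R (Theta e) i in
    (0 <= l)%R /\ (l <= ecost e)%R /\ (ecost e <= u)%R;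
  Theta_nested : forall e, e \in edges ->
    forall i j, (i < j)%N -> (j < size (Theta e))%N ->
    let: (li, ui) := nth (0, 0)%R (Theta e) i in
    let: (lj, uj) := nth (0, 0)%R (Theta e) j in
    `[lj, uj]%classic `<=` `[li, ui]%classic
}.

Section Solutions.
Variables (R : realType) (V : finType) (G : ewdg R V).

Definition adj : rel V := [rel x y | (x, y) \in edges G].

(** A path is the nonempty sequence of its vertices (possibly with repetitions);
    the one-vertex path has no edges. *)
Definition path_edges (p : seq V) : seq (V * V) := zip p (behead p).

Definition uTheta (e : V * V) : R := (last (0, 0)%R (Theta G e)).2.

Definition uTheta_path (p : seq V) : R :=
  (\sum_(e <- path_edges p) uTheta e)%R.

Variables (vs : V) (Vg : {set V}).

Definition solution (p : seq V) : bool :=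
  if p is x :: q then [&& x == vs, path adj x q & last x q \in Vg] else false.

(** The infimum of the empty set is [+oo]; [Ustar_min] below shows that the
    infimum is a minimum as soon as there is a solution. *)
Definition Ustar : \bar R :=
  ereal_inf [set (uTheta_path p)%:E | p in [set p | solution p]].

Lemma uTheta_ge0 e : e \in edges G -> (0 <= uTheta e)%R.
Proof.
move=> eG; have := Theta_neq0 eG; rewrite /uTheta (last_nth (0, 0)%R).
have := Theta_bounds eG; case: (Theta G e) => [|a s] //= /(_ (size s)) + _.
move=> /(_ (ltnSn _)); case: nth => l u [l0 [lc cu]] /=.
exact: le_trans l0 (le_trans lc cu).
Qed.

Lemma uTheta_path_cons x y q :
  uTheta_path [:: x, y & q] = (uTheta (x, y) + uTheta_path (y :: q))%R.
Proof. by rewrite /uTheta_path /path_edges /= big_cons. Qed.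

Lemma simple_path_le x q : path adj x q -> exists q',
  [/\ path adj x q', uniq (x :: q'), last x q' = last x q &
      (uTheta_path (x :: q') <= uTheta_path (x :: q))%R].
Proof.
elim: q x => [|y q IH] x /=; first by move=> _; exists [::].
move=> /andP[xy /IH[q' [pq' uq' lq' cq']]].
have xy0 : (0 <= uTheta (x, y))%R by exact: uTheta_ge0.
have suffix q1 : path adj y q1 -> x \in y :: q1 -> uniq (y :: q1) ->
  exists q2, [/\ path adj x q2, uniq (x :: q2), last x q2 = last y q1 &
      (uTheta_path (x :: q2) <= uTheta_path (y :: q1))%R].
  elim: q1 y {IH xy pq' uq' lq' cq' xy0} => [|z q1 IH1] y.
    by rewrite inE => _ /eqP -> _; exists [::].
  rewrite inE => /[dup] pz /= /andP[yz pz1].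
  have [->|xny /= xz /andP[_ uz]] := eqVneq x y.
    by move=> _ uz; exists (z :: q1).
  have [q2 [? ? ? h]] := IH1 z pz1 xz uz.
  exists q2; split=> //; apply: le_trans h _.
  by rewrite uTheta_path_cons lerDr uTheta_ge0.
have [xq'|xq'] := boolP (x \in y :: q').
  have [q2 [? ? e h]] := suffix _ pq' xq' uq'.
  exists q2; split=> //; first by rewrite e.
  apply: le_trans h (le_trans cq' _).
  by rewrite uTheta_path_cons lerDr.
exists (y :: q'); split=> //=; first exact/andP.
  by move: xq' uq' => /= -> ->.
by rewrite !uTheta_path_cons lerD2l.
Qed.

Lemma Ustar_min p0 : solution p0 ->
  exists2 p, solution p & (uTheta_path p)%:E = Ustar /\
    forall p', solution p' -> (uTheta_path p <= uTheta_path p')%R.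
Proof.
have simpl_sol p : solution p -> exists b : #|V|.-bseq V,
    solution b /\ (uTheta_path b <= uTheta_path p)%R.
  case: p => [|x q] //= /and3P[xs /simple_path_le[q' [pq' uq' lq' cq']] lg].
  have sz : (size (x :: q') <= #|V|)%N.
    by rewrite -(card_uniqP uq') max_card.
  exists (Bseq sz); split => //=.
  by rewrite xs pq' lq' lg.
move=> /simpl_sol[b0 [sb0 _]].
case: (Order.TotalTheory.arg_minP (fun b : #|V|.-bseq V => uTheta_path b)
  (P := fun b : #|V|.-bseq V => solution b) sb0) => b sb minb.
have min p' : solution p' -> (uTheta_path b <= uTheta_path p')%R.
  by move=> /simpl_sol[b' [sb' le]]; apply: le_trans (minb _ sb') le.
exists b => //; split=> //; apply/eqP; rewrite eq_le; apply/andP; split.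
  by apply: le_ereal_inf_tmp => _ [p' /= sp' <-]; rewrite lee_fin min.
by apply: ereal_inf_lbound; exists b.
Qed.

End Solutions.

(** ** The algorithm *)

Section Beast.
Variables (R : realType) (V : finType) (G : ewdg R V) (vs : V) (Vg : {set V}).
Variable uprune : \bar R.

(** The key of a vertex in OPEN is always its current [g_u] value, so OPEN is
    stored as a set. *)
Record state := State {
  g_u : V -> \bar R;
  OPEN : {set V};
  CLOSED : {set V};
  parent : V -> option V
}.

(** [None] stands for the path returned on failure. *)
Definition output := (option (seq V) * \bar R)%type.

Inductive config := Running of state | Returned of output.

(** The values of [g_u] outside [vs] are never read before being set. *)
Definition init : config :=
  Running (State [eta (fun=> +oo) with vs |-> 0] [set vs]%SET finset.set0
                 (fun=> None)).

(** The inner while loop: [lu] holds the current values of l(e) and u(e), and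
    [ths] the estimators that remain; [gn] and [gs] are the values of [g_u] at
    the two ends of the edge. *)
Fixpoint estimate (gn gs : \bar R) (lu : R * R) (ths : seq (R * R)) : R * R :=
  if ths is th :: ths' then
    if (gn + lu.1%:E < gs) && (gn + lu.1%:E <= uprune)
    then estimate gn gs th ths' else lu
  else lu.

Definition process_successor (n : V) (st : state) (s : V) : state :=
  let g := if s \in OPEN st :|: CLOSED st then g_u st
           else [eta g_u st with s |-> +oo] in
  let lu := estimate (g n) (g s) (0, 0)%R (Theta G (n, s)) in
  let gt := g n + lu.2%:E in
  if (gt < g s) && (gt <= uprune)
  then State [eta g with s |-> gt] (s |: OPEN st)%SET (CLOSED st)
             [eta parent st with s |-> Some n]
  else State g (OPEN st) (CLOSED st) (parent st).

(** [traceback par n p]: following the pointers [par] from [n] reaches [vs], and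
    [p] lists the vertices met, from [vs] to [n]. *)
Inductive traceback (par : V -> option V) : V -> seq V -> Prop :=
| Traceback_source : traceback par vs [:: vs]
| Traceback_parent n m p : n <> vs -> par n = Some m ->
    traceback par m p -> traceback par n (rcons p n).

Definition popped (st : state) (n : V) : Prop :=
  n \in OPEN st /\ forall m, m \in OPEN st -> g_u st n <= g_u st m.

(** One iteration of the main loop.  It is nondeterministic: ties between
    minimal vertices of OPEN are broken arbitrarily, and the successors are
    listed in an arbitrary order. *)
Inductive step : config -> config -> Prop :=
| Step_fail st : OPEN st = finset.set0 ->
    step (Running st) (Returned (None, +oo))
| Step_goal st n p : popped st n -> n \in Vg -> traceback (parent st) n p ->
    step (Running st) (Returned (Some p, g_u st n))
| Step_expand st n succs : popped st n -> n \notin Vg ->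
    uniq succs -> succs =i [pred s | adj G n s] ->
    step (Running st)
         (Running (foldl (process_successor n)
                    (State (g_u st) (OPEN st :\ n)%SET (n |: CLOSED st)%SET
                           (parent st))
                    succs)).

(** [eventually Q c]: whatever choices are made, the execution from [c] never
    gets stuck and stops after finitely many iterations, returning an output
    that satisfies [Q]. *)
Inductive eventually (Q : output -> Prop) : config -> Prop :=
| Eventually_returned out : Q out -> eventually Q (Returned out)
| Eventually_step st : (exists c, step (Running st) c) ->
    (forall c, step (Running st) c -> eventually Q c) ->
    eventually Q (Running st).

Definition BEAST_returns (Q : output -> Prop) : Prop := eventually Q init.

End Beast.

(* Main.v *)
Require Import Defs.
From HB Require Import structures.
From mathcomp Require Import all_boot all_order all_algebra.
From mathcomp Require Import all_classical all_reals ereal.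

(** BEAST is Dijkstra's algorithm for the weights [uTheta].  An inner loop that
    stops before the last estimator of [e = (n, s)] does so because
    [g_u n + l] already reaches [g_u s] or exceeds [uprune]; since
    [l <= uTheta e], as well as [l <= u], neither the current bound [u] nor
    [uTheta e] would then improve [g_u s].  Hence each edge is relaxed exactly as
    with [uTheta].  A solution of cost at most [uprune] always has a vertex in
    OPEN whose key is at most that cost, so the first goal vertex popped has key
    [Ustar]. *)

Set Implicit Arguments.
Unset Strict Implicit.
Unset Printing Implicit Defensive.

Import Order.TTheory GRing.Theory Num.Theory.

Local Open Scope ereal_scope.

(** * Path costs and the inner estimation loop *)

Section Graph.
Variables (R : realType) (V : finType) (G : ewdg R V).

Lemma Theta_last_bounds e th : e \in edges G -> th \in Theta G e ->
  (th.1 <= th.2)%R /\ (th.1 <= uTheta G e)%R.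
Proof.
move=> eG /(nthP (0, 0)%R)[i ilt <-].
have := Theta_bounds eG ilt; case: nth => l u [_ [lc cu]] /=.
split; first exact: le_trans lc cu.
apply: le_trans lc _; rewrite /uTheta -nth_last.
have klt : ((size (Theta G e)).-1 < size (Theta G e))%N by case: (Theta G e) ilt.
by have := Theta_bounds eG klt; case: nth => l' u' [_ []].
Qed.

Lemma uTheta_path_ge0 x q : path (adj G) x q -> (0 <= uTheta_path G (x :: q))%R.
Proof.
elim: q x => [|y q IH] x; first by rewrite /uTheta_path /path_edges /= big_nil.
by move=> /= /andP[xy /IH ?]; rewrite uTheta_path_cons addr_ge0// uTheta_ge0.
Qed.

Lemma uTheta_path_rcons x q y :
  uTheta_path G (x :: rcons q y) =
  (uTheta_path G (x :: q) + uTheta G (last x q, y))%R.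
Proof.
elim: q x => [|z q IH] x /=.
  by rewrite uTheta_path_cons /uTheta_path /path_edges /= !big_nil addrC.
by rewrite !uTheta_path_cons IH addrA.
Qed.

Variables (uprune : \bar R).

(* The left conjunct of the first hypothesis holds for the initial [lu = (0, 0)]
   and for every estimator output. *)
Lemma estimate_relax (gn gs : \bar R) (lu : R * R) ths (w : R) :
  (forall th, th \in lu :: ths -> (th.1 <= th.2)%R /\ (th.1 <= w)%R) ->
  (last lu ths).2 = w ->
  let lu' := estimate uprune gn gs lu ths in
  ((gn + lu'.2%:E < gs) && (gn + lu'.2%:E <= uprune) =
   (gn + w%:E < gs) && (gn + w%:E <= uprune)) /\
  ((gn + w%:E < gs) && (gn + w%:E <= uprune) -> lu'.2 = w).
Proof.
elim: ths lu => [|th ths IH] lu Hth /=; first by move=> ->.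
move=> lastw; case: ifPn => [_|stop].
  by apply: IH => // th' th'in; apply: Hth; rewrite inE th'in orbT.
have [lu12 luw] := Hth lu (mem_head _ _).
(* The loop stopped because [lu.1] fails its guard; every larger bound then fails it too, in
   particular both [lu.2] and [w]. *)
have mono (x : R) : (lu.1 <= x)%R ->
    (gn + x%:E < gs) && (gn + x%:E <= uprune) = false.
  move=> lx; apply: contraNF stop => /andP[lt le].
  have le_lx : gn + lu.1%:E <= gn + x%:E by rewrite leeD2l// lee_fin.
  by rewrite (le_lt_trans le_lx lt) (le_trans le_lx le).
by rewrite !mono.
Qed.

End Graph.

(** * Parent pointers and the loop invariant *)

Section Correctness.
Variables (R : realType) (V : finType) (G : ewdg R V) (vs : V) (Vg : {set V}).
Variable uprune : \bar R.

(** Needed to identify the path returned by [Step_goal] with the one that the invariant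
    describes. *)
Lemma traceback_inj (par : V -> option V) n p p' :
  traceback vs par n p -> traceback vs par n p' -> p = p'.
Proof.
move=> tp; elim: tp p' => [|{}n m {}p nvs parn _ IH] p' tp'.
  by inversion tp'.
inversion tp' as [e|n' m' q nvs' parn' tq]; first by case: nvs.
by subst; move: parn'; rewrite parn => -[mm']; subst m'; rewrite (IH q).
Qed.

Lemma traceback_with (par : V -> option V) n p s o :
  traceback vs par n p -> s \notin p ->
  traceback vs [eta par with s |-> o] n p.
Proof.
elim=> [|{}n m {}p nvs parn tp IH]; first by move=> _; exact: Traceback_source.
rewrite mem_rcons inE negb_or => /andP[sn sp].
apply: Traceback_parent nvs _ (IH sp).
by rewrite /= eq_sym (negbTE sn).
Qed.

(* [belast vs q] lists the proper ancestors of [v]: being closed, they keep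
   their parents and their keys. *)
Definition reached (st : state R V) (v : V) (q : seq V) : Prop :=
  [/\ traceback vs (parent st) v (vs :: q), path (adj G) vs q, last vs q = v,
      {subset belast vs q <= CLOSED st} & g_u st v = (uTheta_path G (vs :: q))%:E].

Record invariant (todo : rel V) (st : state R V) : Prop := Invariant {
  inv_disj : forall v, v \in CLOSED st -> v \notin OPEN st;
  inv_source : vs \in OPEN st :|: CLOSED st;
  inv_g_source : g_u st vs = 0;
  inv_unseen : forall v, v \notin OPEN st :|: CLOSED st -> g_u st v = +oo;
  inv_reached : forall v, v \in OPEN st :|: CLOSED st -> exists q, reached st v q;
  inv_mono : forall m v, m \in CLOSED st -> v \in OPEN st -> g_u st m <= g_u st v;
  inv_goal : forall v, v \in CLOSED st -> v \notin Vg;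
  inv_relaxed : forall m v, m \in CLOSED st -> adj G m v -> ~~ todo m v ->
    g_u st m + (uTheta G (m, v))%:E <= uprune ->
    g_u st v <= g_u st m + (uTheta G (m, v))%:E
}.

Lemma inv_ge0 todo st v : invariant todo st -> 0 <= g_u st v.
Proof.
move=> I; have [/(inv_reached I)[q [_ pq _ _ ->]]|/(inv_unseen I)->] :=
  boolP (v \in OPEN st :|: CLOSED st); last by rewrite leey.
by rewrite lee_fin uTheta_path_ge0.
Qed.

Lemma init_invariant :
  invariant [rel _ _ | false]
    (State [eta (fun=> +oo) with vs |-> 0] [set vs]%SET finset.set0
           (fun=> None)).
Proof.
have seen v : v \in [set vs]%SET :|: finset.set0 -> v = vs.
  by rewrite finset.setU0 => /finset.set1P.
split=> //=.
- by move=> v; rewrite finset.in_set0.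
- by rewrite finset.setU0 finset.set11.
- by rewrite eqxx.
- by move=> v; rewrite finset.setU0 finset.in_set1 => /negbTE->.
- move=> v /seen->; exists [::]; split=> //=; first exact: Traceback_source.
  by rewrite eqxx /uTheta_path /path_edges /= big_nil.
- by move=> m v; rewrite finset.in_set0.
- by move=> v; rewrite finset.in_set0.
- by move=> m v; rewrite finset.in_set0.
Qed.

(** * Preservation of the invariant *)

(** By [inv_unseen] the reset of an unseen key to [+oo] changes nothing, and [estimate_relax]
    replaces the estimated bound by the tightest one. *)
Lemma process_successorE todo st n s : invariant todo st -> adj G n s ->
  let gt := g_u st n + (uTheta G (n, s))%:E in
  process_successor G uprune n st s =
  if (gt < g_u st s) && (gt <= uprune)
  then State [eta g_u st with s |-> gt] (s |: OPEN st)%SET (CLOSED st)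
             [eta parent st with s |-> Some n]
  else st.
Proof.
move=> I ns gt; rewrite /process_successor.
have -> : (if s \in OPEN st :|: CLOSED st then g_u st
           else [eta g_u st with s |-> +oo]) = g_u st.
  case: ifPn => // /(inv_unseen I) gs; apply/funext => v /=.
  by case: eqP => // ->.
have Hth th : th \in (0, 0)%R :: Theta G (n, s) ->
    (th.1 <= th.2)%R /\ (th.1 <= uTheta G (n, s))%R.
  rewrite inE => /predU1P[->/=|]; last exact: Theta_last_bounds.
  by rewrite uTheta_ge0.
have /= [-> lastE] := estimate_relax uprune (g_u st n) (g_u st s) Hth erefl.
by case: ifP => [/lastE ->//|_]; case: (st).
Qed.

(** Dijkstra's argument: no closed key exceeds that of [n] and weights are nonnegative, so going
    through [n] never improves a closed vertex. Closed keys and pointers are thus frozen. *)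
Lemma process_successor_invariant n s l st :
  invariant [rel m v | (m == n) && (v \in s :: l)] st -> adj G n s ->
  n \in CLOSED st -> (forall m, m \in CLOSED st -> g_u st m <= g_u st n) ->
  let st' := process_successor G uprune n st s in
  [/\ invariant [rel m v | (m == n) && (v \in l)] st', CLOSED st' = CLOSED st &
      forall m, m \in CLOSED st -> g_u st' m = g_u st m].
Proof.
move=> I ns nC maxn st'; rewrite {}/st' (process_successorE I ns).
set gt := g_u st n + _.
have ngt : g_u st n <= gt by rewrite leeDl// lee_fin uTheta_ge0.
case: ifPn => [/andP[gts gtup]|nupd]; last first.
  split=> //; case: I => I1 I2 I3 I4 I5 I6 I7 I8; split=> // m v mC mv.
  rewrite /= negb_and => td; have [/eqP mn|mn] := boolP (m == n); last first.
    by apply: I8 => //=; rewrite (negbTE mn).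
  have [->|vs_] := eqVneq v s; last first.
    apply: I8 => //=; rewrite mn eqxx/= inE negb_or vs_/=.
    by move: td; rewrite mn eqxx.
  rewrite mn -/gt => gtup; move: nupd; rewrite gtup andbT.
  by rewrite -leNgt.
have sC : s \notin CLOSED st.
  apply: contraTN gts => /maxn sn; rewrite -leNgt.
  exact: le_trans sn ngt.
have svs : s != vs.
  apply: contraTneq gts => ->; rewrite (inv_g_source I) -leNgt.
  exact: le_trans (inv_ge0 n I) ngt.
have neq_s m : m \in CLOSED st -> (m == s) = false.
  by move=> mC; apply: contraNF sC => /eqP <-.
have seen v : v != s -> v \in (s |: OPEN st)%SET :|: CLOSED st ->
    v \in OPEN st :|: CLOSED st.
  by move=> /negbTE vs_; rewrite !finset.inE vs_.
split=> //=; last by move=> m /neq_s ->.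
split=> /=.
- by move=> v vC; rewrite !finset.inE neq_s//= (inv_disj I).
- by have := inv_source I; rewrite !finset.inE => /orP[]->; rewrite !orbT.
- by rewrite eq_sym (negbTE svs) (inv_g_source I).
- move=> v; rewrite !finset.inE !negb_or => /andP[/andP[/negbTE-> vO vC]].
  by rewrite (inv_unseen I)// !finset.inE negb_or vO.
- move=> v vin; have [->|vs_] := eqVneq v s; last first.
    have [q [tq pq lq bq cq]] := inv_reached I (seen _ vs_ vin).
    exists q; split=> //=; last by rewrite (negbTE vs_).
    apply: traceback_with => //; rewrite lastI lq mem_rcons inE negb_or.
    by rewrite eq_sym vs_/=; apply: contra sC => /bq.
  (* The new path to [s] extends the path to [n], whose vertices are all closed; it therefore avoids
     [s] and survives the change of pointer. *)
  have nin : n \in OPEN st :|: CLOSED st by rewrite !finset.inE nC orbT.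
  have [q [tq pq lq bq cq]] := inv_reached I nin.
  have qC : {subset vs :: q <= CLOSED st}.
    by move=> x; rewrite lastI lq mem_rcons inE => /predU1P[->//|/bq].
  exists (rcons q s); split=> /=.
  + rewrite -rcons_cons; apply: (@Traceback_parent _ _ _ _ n).
    * exact/eqP.
    * by rewrite /= eqxx.
    * by apply: traceback_with => //; apply: contra sC => /qC.
  + by rewrite rcons_path pq lq.
  + by rewrite last_rcons.
  + by rewrite belast_rcons.
  + by rewrite eqxx uTheta_path_rcons lq EFinD -cq.
- move=> m v mC; rewrite neq_s// !finset.inE; case: eqVneq => [_ _|_ /= vO].
    exact: le_trans (maxn m mC) ngt.
  exact: inv_mono I _ _ mC vO.
- exact: inv_goal I.
- move=> m v mC mv td; rewrite neq_s// => mup.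
  (* The edge from [n] to [s] becomes tight; other edges into [s] stay relaxed because the key of
     [s] only decreases. *)
  have [vs_|vs_] := eqVneq v s.
    have [->|mn] := eqVneq m n; first by rewrite vs_.
    have svm : g_u st v <= g_u st m + (uTheta G (m, v))%:E.
      by apply: (inv_relaxed I) => //=; rewrite (negbTE mn).
    by rewrite (le_trans (ltW gts))// -vs_.
  apply: (inv_relaxed I) => //=; rewrite inE (negbTE vs_).
  exact: td.
Qed.

Lemma process_successors_invariant n succs st :
  invariant [rel m v | (m == n) && (v \in succs)] st ->
  {subset succs <= adj G n} ->
  n \in CLOSED st -> (forall m, m \in CLOSED st -> g_u st m <= g_u st n) ->
  let st' := foldl (process_successor G uprune n) st succs in
  invariant [rel _ _ | false] st' /\ CLOSED st' = CLOSED st.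
Proof.
elim: succs st => [|s l IH] st /= I adjl nC maxn.
  split=> //; case: I => I1 I2 I3 I4 I5 I6 I7 I8; split=> // m v mC mv _.
  by apply: I8 => //=; rewrite in_nil andbF.
have ns : adj G n s by exact: (adjl s (mem_head _ _)).
have [I' C' g'] := process_successor_invariant I ns nC maxn.
rewrite -C'; apply: IH => //; rewrite ?C'//.
- by move=> v vl; apply: adjl; rewrite inE vl orbT.
- by move=> m mC; rewrite !g'// maxn.
Qed.

Lemma expand_invariant st n succs :
  invariant [rel _ _ | false] st -> popped st n -> n \notin Vg ->
  succs =i [pred s | adj G n s] ->
  let st' := foldl (process_successor G uprune n)
               (State (g_u st) (OPEN st :\ n)%SET (n |: CLOSED st)%SET
                      (parent st)) succs in
  invariant [rel _ _ | false] st' /\ CLOSED st' = (n |: CLOSED st)%SET.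
Proof.
move=> I [nO minn] nVg succsE.
have seenE : (OPEN st :\ n)%SET :|: (n |: CLOSED st)%SET =
    OPEN st :|: CLOSED st.
  by apply/finset.setP => v; rewrite !finset.inE; case: eqVneq => // ->; rewrite nO.
apply: process_successors_invariant => /=.
- split=> /=; rewrite ?seenE.
  + move=> v; rewrite !finset.inE; case: eqVneq => //= _; exact: inv_disj I v.
  + exact: inv_source I.
  + exact: inv_g_source I.
  + exact: inv_unseen I.
  + move=> v /(inv_reached I)[q [? ? ? bq ?]]; exists q; split=> //= x /bq xC.
    by rewrite finset.inE xC orbT.
  + move=> m v; rewrite !finset.inE => /predU1P[->|mC] /andP[_ vO].
      exact: minn.
    exact: inv_mono I _ _ mC vO.
  + move=> v; rewrite !finset.inE => /predU1P[->//|]; exact: inv_goal I v.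
  + move=> m v; rewrite !finset.inE => /predU1P[->|mC] mv.
      by rewrite eqxx succsE inE mv.
    by move=> _; exact: (inv_relaxed I).
- by move=> v; rewrite succsE.
- by rewrite finset.setU11.
- move=> m; rewrite !finset.inE => /predU1P[->//|mC]; exact: inv_mono I _ _ mC nO.
Qed.

(** * Termination and optimality *)

(** Termination: each expansion closes a vertex that was open, hence not closed, so the complement
    of [CLOSED] shrinks. *)
Lemma eventually_invariant (Q : output R V -> Prop) :
  (forall st, invariant [rel _ _ | false] st -> OPEN st = finset.set0 ->
     Q (None, +oo)) ->
  (forall st n q, invariant [rel _ _ | false] st -> popped st n -> n \in Vg ->
     reached st n q -> Q (Some (vs :: q), g_u st n)) ->
  forall st, invariant [rel _ _ | false] st ->
  Defs.eventually G vs Vg uprune Q (Running st).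
Proof.
move=> Qfail Qgoal st; have [k] := ubnP #|~: CLOSED st|.
elim: k st => // k IH st ltk I; apply: Eventually_step; last first.
  move=> c stc; inversion stc as [st' O0|st' n p popn ng tp|
    st' n succs popn ng _ succsE]; subst.
  - exact/Eventually_returned/(Qfail st).
  - apply: Eventually_returned.
    have [|q rq] := inv_reached I (v := n).
      by rewrite finset.inE; case: popn => ->.
    have [tq _ _ _ _] := rq.
    by rewrite (traceback_inj tp tq); exact: Qgoal.
  - have [I' C'] := expand_invariant I popn ng succsE.
    apply: IH I'; rewrite C'; move: ltk; rewrite ltnS; apply: leq_trans.
    apply: proper_card; rewrite finset.properC.
    rewrite properE finset.subsetUr/=; apply/subsetPn; exists n.
      exact: finset.setU11.
    by apply: contraL (popn.1) => /(inv_disj I).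
(* The execution is never stuck: a nonempty finite [OPEN] has a minimal vertex, and for a goal the
   invariant supplies the traceback. *)
have [O0|[n0 n0O]] := finset.set_0Vmem (OPEN st).
  by exists (Returned (None, +oo)); apply: Step_fail.
have [n popn] : exists n, popped st n.
  have [n nO minn] := arg_minP (g_u st) n0O.
  by exists n; split.
have [ng|ng] := boolP (n \in Vg).
  have [|q [tq _ _ _ _]] := inv_reached I (v := n).
    by rewrite finset.inE; case: popn => ->.
  by eexists; apply: Step_goal tq.
eexists; apply: (@Step_expand _ _ _ _ _ _ st n (enum [pred s | adj G n s])) => //.
  exact: enum_uniq.
by move=> s; rewrite mem_enum.
Qed.

(** Walk to the first open vertex of the path: a closed vertex passes the bound on to its successor
    by [inv_relaxed], and the final goal cannot be closed. Nonnegative weights keep the cost of each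
    prefix within [uprune]. *)
Lemma frontier_le st x q : invariant [rel _ _ | false] st ->
  x \in OPEN st :|: CLOSED st -> path (adj G) x q -> last x q \in Vg ->
  g_u st x + (uTheta_path G (x :: q))%:E <= uprune ->
  exists2 v, v \in OPEN st & g_u st v <= g_u st x + (uTheta_path G (x :: q))%:E.
Proof.
move=> I; elim: q x => [|y q IH] x; rewrite finset.inE => /orP[xO|xC].
- by exists x => //; rewrite leeDl// lee_fin uTheta_path_ge0.
- by move=> _ /= xg; have := inv_goal I xC; rewrite xg.
- by move=> pq _ _; exists x => //; rewrite leeDl// lee_fin uTheta_path_ge0.
move=> /= /andP[xy pq] lq; rewrite uTheta_path_cons EFinD addeA => costle.
have pq0 : 0 <= (uTheta_path G (y :: q))%:E by rewrite lee_fin uTheta_path_ge0.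
have gy : g_u st y <= g_u st x + (uTheta G (x, y))%:E.
  by apply: (inv_relaxed I) => //; apply: le_trans costle; rewrite leeDl.
have [|q' [_ _ _ _ gx]] := inv_reached I (v := x); first by rewrite finset.inE xC orbT.
(* An unseen [y] would have key [+oo], whereas [gy] bounds it by a finite value. *)
have yin : y \in OPEN st :|: CLOSED st.
  by apply: contraPT gy => /(inv_unseen I)->; rewrite gx -EFinD leye_eq.
have le_cost := leeD2r (uTheta_path G (y :: q))%:E gy.
have [v vO gv] := IH y yin pq lq (le_trans le_cost costle).
by exists v => //; exact: le_trans gv le_cost.
Qed.

Lemma frontier_solution st p : invariant [rel _ _ | false] st ->
  solution G vs Vg p -> (uTheta_path G p)%:E <= uprune ->
  exists2 v, v \in OPEN st & g_u st v <= (uTheta_path G p)%:E.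
Proof.
move=> I; case: p => [//|x q] /= /and3P[/eqP-> pq lq].
rewrite -[(uTheta_path _ _)%:E]add0e -(inv_g_source I).
exact: frontier_le (inv_source I) pq lq.
Qed.

Lemma reached_solution st n q : reached st n q -> n \in Vg ->
  solution G vs Vg (vs :: q).
Proof. by case=> _ pq lq _ _ ng; rewrite /= eqxx pq lq. Qed.

End Correctness.

Theorem theorem3 (R : realType) (V : finType) (G : ewdg R V) (vs : V)
    (Vg : {set V}) (uprune : \bar R) :
  Ustar G vs Vg <= uprune ->
  ((exists p, solution G vs Vg p) ->
     BEAST_returns G vs Vg uprune (fun out =>
       exists2 p, solution G vs Vg p /\ (uTheta_path G p)%:E = Ustar G vs Vg
                & out = (Some p, Ustar G vs Vg))) /\
  (~ (exists p, solution G vs Vg p) ->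
     BEAST_returns G vs Vg uprune (fun out => out = (None, +oo))).
Proof.
move=> Uup; have init_inv := init_invariant G vs Vg uprune.
split=> [[p0 /Ustar_min[p solp [pU minp]]]|nosol];
  apply: eventually_invariant init_inv => //.
- move=> st I O0; have [|v] := frontier_solution I solp; first by rewrite pU.
  by rewrite O0 finset.in_set0.
- move=> st n q I [_ minn] ng rq; have solq := reached_solution rq ng.
  have [_ _ _ _ gn] := rq.
  have [|v vO gv] := frontier_solution I solp; first by rewrite pU.
  (* The key of [n] is at most that of the frontier vertex [v], and at least the optimum because it
     is the cost of a solution. *)
  have gnU : g_u st n = Ustar G vs Vg.
    apply/eqP; rewrite eq_le -pU (le_trans (minn v vO) gv)/=.
    by rewrite gn lee_fin minp.
  by exists (vs :: q); rewrite -?gn gnU.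
- by move=> st n q _ _ ng /reached_solution/(_ ng) sol; case: nosol; exists (vs :: q).
Qed.
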